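(* Let $s$ be a Sturmian word of slope $\alpha$, and let $\overline{\mathcal{O}}(s)$ be its orbit closure under the shift. If $S_\beta$ is the smallest $\beta$-shift (over all $\beta>1$) containing $\overline{\mathcal{O}}(s)$, then $\overline{\{\sigma^n(d_\beta(1))\}}_{n\geq 0}=\overline{\mathcal{O}}(s)$, and $\beta$ is the unique solution $x>1$ of $$1=\sum_{n=0}^{\infty}\frac{s'_{\alpha,0}(n)}{x^{n+1}},$$ where $s'_{\alpha,0}(n)=\lceil\alpha(n+1)\rceil-\lceil\alpha n\rceil$.
   Context: A Sturmian word is an infinite word $s\in\{0,1\}^{\mathbb{N}}$ having exactly $n+1$ distinct factors of length $n$ for each $n\geq0$; its slope is $\lim_n h(s_0\cdots s_{n-1})/n$ where $h(u)$ counts the $1$'s in $u$. $\sigma$ is the shift map and $\overline{\mathcal{O}}(s)$ is the closure of $\{\sigma^n(s):n\geq 0\}$ in the product topology. For $\beta>1$, $T_\beta:[0,1]\to[0,1)$, $T_\beta(x)=\beta x \bmod 1$; the $\beta$-expansion of $x\in[0,1]$ is $d_\beta(x)=(x_i)_{i\geq1}$ with $x_i=\lfloor \beta T_\beta^{i-1}(x)\rfloor$. The $\beta$-shift $S_\beta$ is the closure in $\{0,1,\dots,\lfloor\beta\rfloor\}^{\mathbb{N}}$ of $\{d_\beta(x):x\in[0,1)\}$. Words in $\{0,1\}^{\mathbb N}$ are regarded as elements of these sequence spaces. *)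

(* Defs.v *)
From HB Require Import structures.
From mathcomp Require Import all_boot all_order all_algebra.
From mathcomp Require Import all_classical all_reals all_analysis.

Set Implicit Arguments.
Unset Strict Implicit.
Unset Printing Implicit Defensive.

Import Order.TTheory GRing.Theory Num.Theory.
Import numFieldNormedType.Exports.

Local Open Scope classical_set_scope.
Local Open Scope ring_scope.

(* Infinite words over every alphabet {0, ..., k} live in the common space
   nat^nat, with the product of the discrete topologies; {0, ..., k}^nat is
   closed in it, so closures taken in either space agree. The bare arrow type
   nat -> nat would carry the topology of uniform convergence instead. *)
Notation word := {ptws nat -> nat}.

Definition shift (w : word) : word := fun i => w i.+1.

Definition orbit_closure (w : word) : set word :=
  closure (range (fun n : nat => iter n shift w)).

Definition factor (w : word) (i n : nat) : seq nat :=
  mkseq (fun j => w (i + j)%N) n.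

Definition factors (w : word) (n : nat) : set (seq nat) :=
  range (fun i : nat => factor w i n).

Definition binary (w : word) : Prop := forall i, (w i < 2)%N.

Definition sturmian (w : word) : Prop :=
  binary w /\ forall n : nat, (factors w n #= `I_n.+1)%card.

Definition height (u : seq nat) : nat := count_mem 1%N u.

Definition has_slope (R : realType) (w : word) (alpha : R) : Prop :=
  (fun n : nat => (height (factor w 0 n))%:R / n%:R : R) @ \oo --> alpha.

Section BetaShift.
Variable R : realType.
Implicit Types beta x : R.

Definition beta_map beta x : R := beta * x - (Num.floor (beta * x))%:~R.

(* Digits are indexed from 0. For beta > 1 and 0 <= x the argument of truncn
   is nonnegative, so truncn is the floor. *)
Definition beta_expansion beta x : word :=
  fun i => Num.truncn (beta * iter i (beta_map beta) x).

Definition beta_shift beta : set word :=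
  closure [set beta_expansion beta x | x in [set x : R | 0 <= x < 1]].

Definition smallest_beta_shift beta (A : set word) : Prop :=
  [/\ 1 < beta, A `<=` beta_shift beta &
      forall beta', 1 < beta' -> A `<=` beta_shift beta' ->
        beta_shift beta `<=` beta_shift beta'].

Definition mechanical' (alpha : R) (n : nat) : int :=
  Num.ceil (alpha * n.+1%:R) - Num.ceil (alpha * n%:R).

End BetaShift.

(* Main.v *)
Require Import Defs.
From HB Require Import structures.
From mathcomp Require Import all_boot all_order all_algebra.
From mathcomp Require Import finmap.
From mathcomp Require Import all_classical all_reals all_analysis.
From mathcomp Require Import zify ring lra.

Set Implicit Arguments.
Unset Strict Implicit.
Unset Printing Implicit Defensive.

Import Order.TTheory GRing.Theory Num.Theory.
Import numFieldNormedType.Exports.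
(* MathComp also defines [factor] and [shift]. *)
Import Defs.

Local Open Scope classical_set_scope.
Local Open Scope ring_scope.

(** Write w = s'_{alpha,0} and let S_b(x, n) be the sum of x_i / b^(i+1) over
    i < n.

    Complexity n + 1 forces s to be balanced: a shortest violation is a pair
    0p0, 1p1 with p a palindrome, and as there is only one right special factor
    of each length, s would then be ultimately periodic. Balance gives
    |ones(u) - alpha |u|| < 1 for all factors u and the irrationality of alpha.
    Starting s where its discrepancy is minimal on a long window exhibits any
    given prefix of w inside s; since w is not ultimately periodic, it has at
    least n + 1 factors of length n, so w and s have the same factors and the
    same orbit closure. Subadditivity of the ceiling shows that w is
    lexicographically maximal in this orbit closure.

    Every word t of the beta-shift satisfies S_beta(t, n) <= 1, so
    S_beta(w, n) <= 1 for all n. If these sums stayed below some c < 1, then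
    S_b(w, n) <= 1 would still hold for some b < beta; by lexicographic
    maximality of w the orbit closure would lie in the b-shift, which does not
    contain the beta-shift, against minimality. So the sums tend to 1 at beta,
    and with maximality this yields d_beta(1) = w. *)

(** * Words, factors and special factors *)

Lemma eq_factorP (x y : word) i j n :
  factor x i n = factor y j n <->
  forall k, (k < n)%N -> x (i + k)%N = y (j + k)%N.
Proof.
split=> [e k kn|e].
  by have := congr1 (fun u => nth 0%N u k) e; rewrite !nth_mkseq.
by apply/eq_in_map => k; rewrite mem_iota => /andP[_]; exact: e.
Qed.

Lemma factorS (x : word) i n :
  factor x i n.+1 = rcons (factor x i n) (x (i + n)%N).
Proof. exact: mkseqS. Qed.

Lemma iter_shiftE n (x : word) i : iter n shift x i = x (n + i)%N.
Proof. by elim: n i => //= n IH i; rewrite /shift IH addnS. Qed.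

(** Cylinders fixing finitely many letters form a neighbourhood basis of the product topology, so
    membership in a closure is tested on prefixes. *)
Lemma closure_wordP (A : set word) (t : word) :
  closure A t <->
  forall n, exists2 a, A a & forall i, (i < n)%N -> a i = t i.
Proof.
split=> [clA n|H].
  have : nbhs t [set a : word | forall i, (i < n)%N -> a i = t i].
    elim: n => [|n IH]; first by near=> a => i.
    have Hn : nbhs t [set a : word | a n = t n].
      apply: (@proj_continuous nat (fun=> nat) n t [set t n]).
      exact: discrete_set1.
    near=> a => i; rewrite ltnS leq_eqVlt => /orP[/eqP ->|].
      by near: a.
    by move: i; near: a.
  by move=> /clA [a [Aa Ha]]; exists a.
have /choice[a Ha] : forall n, exists a : word,
    A a /\ forall i, (i < n)%N -> a i = t i.
  by move=> n; have [a] := H n; exists a.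
have at_cvg : (a @ \oo) --> (t : word).
  apply/pointwise_cvgP => i B /nbhs_singleton Bt.
  exists i.+1 => // n /= ni; rewrite /= (Ha n).2 //.
move=> B /at_cvg [N _ HN]; exists (a N); split; first exact: (Ha N).1.
by apply: HN => /=.
Unshelve. all: by end_near.
Qed.

Lemma orbit_closureP (x t : word) :
  orbit_closure x t <-> forall n, factors x n (factor t 0 n).
Proof.
rewrite /orbit_closure; split=> [/closure_wordP H n|H].
  have [_ [k _ <-] Hk] := H n; exists k => //.
  by apply/eq_factorP => i /Hk <-; rewrite iter_shiftE.
apply/closure_wordP => n; have [k _ /eq_factorP Hk] := H n.
exists (iter k shift x); first by exists k.
by move=> i /Hk; rewrite iter_shiftE.
Qed.

(** * Special factors and ultimate periodicity *)

Definition ultimately_periodic (x : word) : Prop :=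
  exists N p, (0 < p)%N /\ forall n, (N <= n)%N -> x (n + p)%N = x n.

Definition right_special (x : word) (n : nat) (u : seq nat) : Prop :=
  exists i j,
    [/\ factor x i n = u, factor x j n = u & x (i + n)%N <> x (j + n)%N].

Lemma nonspecial_factorS (x : word) n i j :
  ~ right_special x n (factor x i n) -> factor x i n = factor x j n ->
  factor x i.+1 n = factor x j.+1 n /\ x (i + n)%N = x (j + n)%N.
Proof.
move=> ns e; have en : x (i + n)%N = x (j + n)%N.
  by apply: contrapT => ne; apply: ns; exists i, j.
split=> //; apply/eq_factorP => k; rewrite leq_eqVlt => /orP[/eqP kn|kn].
  by rewrite !addSn -!addnS kn.
by rewrite !addSn -!addnS; move/eq_factorP: e; apply.
Qed.

(** Pigeonhole yields two equal windows at offsets [a < b]. A window that is not right special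
    determines the next one, so the coincidence propagates: each later window equals one starting
    between [i + a] and [i + b], hence is not special either. *)
Lemma nonspecial_ultimately_periodic (x : word) n i (T : seq (seq nat)) :
  (forall t, (t <= size T)%N -> factor x (i + t) n \in T /\
     ~ right_special x n (factor x (i + t) n)) ->
  ultimately_periodic x.
Proof.
move=> H.
have : ~~ uniq (mkseq (fun t => factor x (i + t) n) (size T).+1).
  apply/negP => /uniq_leq_size sub; have /sub :
      {subset mkseq (fun t => factor x (i + t) n) (size T).+1 <= T}.
    by move=> u /mapP[t]; rewrite mem_iota add0n ltnS => /andP[_] /H[+ _] ->.
  by rewrite size_mkseq ltnn.
move=> /(uniqPn [::])[a [b [ab]]]; rewrite size_mkseq => bT.
rewrite !nth_mkseq ?(ltn_trans ab bT)// => eab.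
have inv t : (i + a <= t)%N -> (exists2 r, (i + a <= r < i + b)%N &
    factor x r n = factor x t n) /\
    factor x t n = factor x (t + (b - a)) n.
  elim: t => [|t IH]; first by case: i a ab eab {H} => [|i] [|a] // *; split;
    [exists 0%N; rewrite // add0n | rewrite add0n subn0].
  rewrite leq_eqVlt => /orP[/eqP <-|].
    split; first by exists (i + a)%N => //; rewrite leqnn ltn_add2l.
    by rewrite -addnA subnKC // ltnW.
  rewrite ltnS => /IH [[r /andP[r1 r2] er] et].
  have nr : ~ right_special x n (factor x r n).
    have -> : (r = i + (r - i))%N by lia.
    by have := H (r - i)%N; case=> //; lia.
  have [er1 _] := nonspecial_factorS nr er.
  rewrite er in nr; have [et1 _] := nonspecial_factorS nr et.
  split=> //; rewrite -er1.
  have [lt|ge] := ltnP r.+1 (i + b)%N; first by exists r.+1 => //; lia.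
  by exists (i + a)%N; [lia|rewrite eab; congr factor; lia].
exists (i + a + n)%N, (b - a)%N; split; first lia.
move=> m Hm; have [|[r r12 er] et] := inv (m - n)%N; first lia.
have nr : ~ right_special x n (factor x (m - n) n).
  rewrite -er; have -> : (r = i + (r - i))%N by lia.
  by have := H (r - i)%N; case=> //; lia.
have [_] := nonspecial_factorS nr et.
have -> : (m - n + (b - a) + n = m + (b - a))%N by lia.
by have -> : (m - n + n = m)%N by lia.
Qed.

(** Each factor in [L] has at least one right extension, each one in [K] a second one. *)
Lemma factors_extend (x : word) n (L K : seq (seq nat)) :
  uniq L -> (forall u, u \in L -> factors x n u) ->
  uniq K -> {subset K <= L} -> (forall u, u \in K -> right_special x n u) ->
  exists L', [/\ uniq L', size L' = (size L + size K)%N &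
    forall u, u \in L' -> factors x n.+1 u].
Proof.
move=> uL LF uK KL KS.
have /choice[c Hc] : forall u, exists a, u \in L -> factors x n.+1 (rcons u a).
  move=> u; case: (boolP (u \in L)) => [/LF[i _ <-]|_]; last by exists 0%N.
  by exists (x (i + n)%N) => _; exists i => //; rewrite factorS.
have /choice[c' Hc'] : forall u, exists a, u \in K ->
    factors x n.+1 (rcons u a) /\ a != c u.
  move=> u; case: (boolP (u \in K)) => [uKK|_]; last by exists 0%N.
  have [i [j [ei ej /eqP ne]]] := KS _ uKK.
  have [e|e] := eqVneq (x (i + n)%N) (c u).
    exists (x (j + n)%N) => _; split; last by rewrite -e eq_sym.
    by exists j => //; rewrite factorS ej.
  exists (x (i + n)%N) => _; split=> //.
  by exists i => //; rewrite factorS ei.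
exists ([seq rcons u (c u) | u <- L] ++ [seq rcons u (c' u) | u <- K]); split.
- rewrite cat_uniq !map_inj_in_uniq ?uL ?uK ?andbT /=; first last.
  + by move=> u v _ _ /rcons_inj[].
  + by move=> u v _ _ /rcons_inj[].
  apply/hasPn => v /mapP[u uKK ->]; apply/negP => /mapP[u' _ /rcons_inj[<-]].
  by have [_ /eqP] := Hc' _ uKK.
- by rewrite size_cat !size_map.
- move=> v; rewrite mem_cat => /orP[] /mapP[u uu ->]; first exact: Hc.
  by have [] := Hc' _ uu.
Qed.

Lemma sturmian_factors_seq (s : word) n : sturmian s ->
  exists L, [/\ uniq L, size L = n.+1 & forall u, u \in L <-> factors s n u].
Proof.
move=> [_ /(_ n) Hn]; exists (finmap.enum_fset (fset_set (factors s n))).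
have fin : finite_set (factors s n) by apply/finite_setP; exists n.+1.
split; [exact: finmap.fset_uniq|exact: card_fset_set|].
move=> u; have -> : (u \in finmap.enum_fset (fset_set (factors s n))) =
  (u \in fset_set (factors s n)) by [].
by rewrite in_fset_set //; split=> [/set_mem|/mem_set].
Qed.

(** Every window equals one starting before [N + p], which leaves at most [N + p] factors of length
    [N + p], one too few. *)
Lemma sturmian_not_ultimately_periodic (s : word) :
  sturmian s -> ~ ultimately_periodic s.
Proof.
move=> st [N [p [p0 per]]].
have [L [uL sL LF]] := sturmian_factors_seq (N + p) st.
have rep i : exists2 j, (j < N + p)%N & forall k, s (i + k)%N = s (j + k)%N.
  elim/ltn_ind: i => i IH; have [lt|ge] := ltnP i (N + p); first by exists i.
  have [|j jlt Hj] := IH (i - p)%N; first lia.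
  exists j => // k; have -> : (i + k = i - p + k + p)%N by lia.
  by rewrite per ?Hj; last lia.
have /(uniq_leq_size uL) :
    {subset L <= mkseq (fun i => factor s i (N + p)) (N + p)}.
  move=> u /LF[i _ <-]; have [j jlt Hj] := rep i.
  apply/mapP; exists j; first by rewrite mem_iota.
  by apply/eq_factorP => k _; exact: Hj.
by rewrite size_mkseq sL ltnn.
Qed.

Lemma sturmian_right_special_unique (s : word) n u v : sturmian s ->
  right_special s n u -> right_special s n v -> u = v.
Proof.
move=> st su sv; apply: contrapT => /eqP uv.
have [L [uL sL LF]] := sturmian_factors_seq n st.
have [L1 [uL1 sL1 LF1]] := sturmian_factors_seq n.+1 st.
have sF w : right_special s n w -> w \in L.
  by move=> [i [_ [<- _ _]]]; apply/LF; exists i.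
have [] := @factors_extend s n L [:: u; v] uL.
- by move=> w /LF.
- by rewrite /= inE uv.
- by move=> w; rewrite !inE => /orP[] /eqP ->; exact: sF.
- by move=> w; rewrite !inE => /orP[] /eqP ->.
move=> L' [uL' sL' LF'].
have /(uniq_leq_size uL') : {subset L' <= L1} by move=> w /LF' /LF1.
by rewrite sL' sL sL1 /=; lia.
Qed.

Lemma sturmian_right_special_exists (s : word) n : sturmian s ->
  exists u, right_special s n u.
Proof.
move=> st; apply: contrapT => ns.
have [L [uL sL LF]] := sturmian_factors_seq n st.
apply: (sturmian_not_ultimately_periodic st).
apply: (@nonspecial_ultimately_periodic s n 0 L) => t _; split.
  by apply/LF; exists t; rewrite // add0n.
by move=> sp; apply: ns; exists (factor s (0 + t) n).
Qed.

(* With [w] a palindrome and [a <> b] letters: no occurrence of [bw] starts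
   inside an occurrence of [awa]. *)
Lemma palindrome_avoid (s : word) i j m t :
  s i <> s j -> s (j + m.+1)%N = s j ->
  (forall k, (k < m)%N -> s (i + k.+1)%N = s (j + k.+1)%N) ->
  (forall k, (k < m)%N -> s (i + k.+1)%N = s (i + (m - k))%N) ->
  (t <= m.+1)%N -> factor s (j + t) m.+1 <> factor s i m.+1.
Proof.
move=> ne ejm eij pal tm /eq_factorP e; apply: ne.
have := e 0%N isT; rewrite !addn0.
have [->|t0] := posnP t; first by rewrite addn0.
have [->|tm1] := eqVneq t m.+1; first by rewrite ejm.
move=> <-; have := e (m.+1 - t)%N; rewrite -addnA subnKC // ejm.
have := eij t.-1; have := pal (m - t)%N;
rewrite prednK // -subSn ?subKn; [|lia..].
by move=> p1 p2 p3; rewrite p3 ?p1 ?p2 //; lia.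
Qed.

(** Let a = [s i], b = [s j] and p the common middle. As p is the only right special factor of its
    length, the one of length m + 1 is ap or bp, by symmetry ap. The m + 2 windows of that length
    starting at [j], ..., [j + m.+1] avoid ap, so none is special and they take at most m + 1
    values. *)
Lemma sturmian_no_palindrome_pair (s : word) i j m : sturmian s ->
  s i <> s j -> s (i + m.+1)%N = s i -> s (j + m.+1)%N = s j ->
  (forall k, (k < m)%N -> s (i + k.+1)%N = s (j + k.+1)%N) ->
  (forall k, (k < m)%N -> s (i + k.+1)%N = s (i + (m - k))%N) -> False.
Proof.
move=> st; wlog : i j / right_special s m.+1 (factor s i m.+1).
  move=> W ne ei ej eij pal.
  have [z sz] := sturmian_right_special_exists m.+1 st.
  have [p [q [ep eq nepq]]] := sz.
  have em : factor s i.+1 m = factor s p.+1 m.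
    apply: (@sturmian_right_special_unique s m) => //.
      exists i.+1, j.+1; split=> //; last by rewrite !addSn -!addnS ei ej.
      by apply/eq_factorP => k km; rewrite !addSn -!addnS eij.
    exists p.+1, q.+1; split=> //; last by rewrite !addSn -!addnS.
    apply/eq_factorP => k km; rewrite !addSn -!addnS.
    by move: ep; rewrite -eq => /eq_factorP ->.
  have bin := st.1.
  have spij : s p = s i \/ s p = s j.
    by have := bin p; have := bin i; have := bin j; lia.
  case: spij => e.
    apply: (W i j) => //.
    suff <- : z = factor s i m.+1 by [].
    rewrite -ep; apply/eq_factorP => -[|k] km; first by rewrite !addn0.
    by move/eq_factorP: em => /(_ k km); rewrite !addSn -!addnS.
  apply: (W j i) => //.
  - suff <- : z = factor s j m.+1 by [].
    rewrite -ep; apply/eq_factorP => -[|k] km; first by rewrite !addn0.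
    by move/eq_factorP: em => /(_ k km); rewrite !addSn -!addnS -eij // => ->.
  - exact/nesym.
  - by move=> k km; rewrite eij.
  - move=> k km; rewrite -eij // pal // .
    have -> : (m - k = (m - k.+1).+1)%N by lia.
    by rewrite eij //; lia.
move=> sp ne ei ej eij pal.
have [L [uL sL LF]] := sturmian_factors_seq m.+1 st.
have iL : factor s i m.+1 \in L by apply/LF; exists i.
apply: (sturmian_not_ultimately_periodic st).
apply: (@nonspecial_ultimately_periodic s m.+1 j (rem (factor s i m.+1) L)).
rewrite size_rem // sL /= => t tm.
have ne' := @palindrome_avoid s i j m t ne ej eij pal tm.
split; last by move=> /(sturmian_right_special_unique st sp); exact/nesym.
rewrite mem_rem_uniq // !inE; apply/andP; split; first exact/eqP.
by apply/LF; exists (j + t)%N.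
Qed.

(** * Counts of ones and balance *)

Definition ones (x : word) (n : nat) : nat := (\sum_(0 <= i < n) x i)%N.

Lemma ones0 (x : word) : ones x 0 = 0%N.
Proof. exact: big_geq. Qed.

Lemma onesS (x : word) n : ones x n.+1 = (ones x n + x n)%N.
Proof. exact: big_nat_recr. Qed.

(* A pair of factors violating balance in minimal length is [0w0], [1w1] with
   [w] a palindrome. *)
Lemma sturmian_balanced (s : word) n i j : sturmian s ->
  (ones s (i + n) + ones s j <= ones s (j + n) + ones s i + 1)%N.
Proof.
move=> st; have bin := st.1.
elim/ltn_ind: n i j => n IH i j; rewrite leqNgt; apply/negP => viol.
case: n IH viol => [|[|m]] IH viol; first by move: viol; rewrite !addn0; lia.
  by move: viol; rewrite !addn1 !onesS; have := bin i; have := bin j; lia.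
(* Cut at [k]: by minimality each piece has excess at most 1, while the total excess is at least
   2. *)
have H1 k : (0 < k < m.+2)%N ->
    (ones s (i + k) + ones s j = ones s (j + k) + ones s i + 1)%N.
  move=> /andP[k0 km]; have h1 := IH k km i j.
  have := IH (m.+2 - k)%N _ (i + k)%N (j + k)%N.
  by rewrite -!addnA !subnKC ?(ltnW km)// => /(_ _) h2; move: h2; lia.
have H2 : (ones s (i + m.+2) + ones s j = ones s (j + m.+2) + ones s i + 2)%N.
  have := H1 m.+1; rewrite ltnSn => /(_ isT); move: viol.
  rewrite ![(_ + m.+2)%N]addnS !onesS.
  by have := bin (i + m.+1)%N; lia.
(* Comparing the prefix of each window with the suffix of the other: prefix and suffix of length [k]
   at [j] have equally many ones, whence the palindrome. *)
have H3 k : (0 < k < m.+2)%N -> (ones s (j + k) + ones s (j + (m.+2 - k)) =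
    ones s (j + m.+2) + ones s j)%N.
  move=> /andP[k0 km].
  have := IH k km (i + (m.+2 - k))%N j; have := IH k km i (j + (m.+2 - k))%N.
  rewrite -!addnA !subnK ?(ltnW km)//.
  have := H1 k; have := H1 (m.+2 - k)%N; rewrite km k0 /=; lia.
have si : s i = 1%N /\ s j = 0%N.
  have := H1 1%N isT; rewrite !addn1 !onesS.
  by have := bin i; have := bin j; lia.
have eij : forall k, (k < m)%N -> s (j + k.+1)%N = s (i + k.+1)%N.
  move=> k km; have := H1 k.+1; have := H1 k.+2.
  by rewrite ![(_ + k.+2)%N]addnS !onesS; lia.
have elast : s (i + m.+1)%N = 1%N /\ s (j + m.+1)%N = 0%N.
  have := H1 m.+1; rewrite ltnSn => /(_ isT); move: H2.
  rewrite ![(_ + m.+2)%N]addnS !onesS.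
  by have := bin (i + m.+1)%N; have := bin (j + m.+1)%N; lia.
case: si elast => si sj [eli elj].
apply: (@sturmian_no_palindrome_pair s j i m) => //.
- by rewrite si sj.
- by rewrite elj.
- by rewrite eli.
move=> k km; have := H3 k.+1; have := H3 k.+2.
have -> : (m.+2 - k.+1 = (m - k).+1)%N by lia.
have -> : (m.+2 - k.+2 = m - k)%N by lia.
by rewrite ![(_ + k.+2)%N]addnS ![(_ + (m - k).+1)%N]addnS !onesS; lia.
Qed.

(** Morse-Hedlund count: without ultimate periodicity [x] has a right special factor of each length,
    hence at least [n + 1] factors of length [n], which exhausts those of [s]. *)
Lemma sturmian_factors_eq (s x : word) n : sturmian s ->
  ~ ultimately_periodic x -> (forall m, factors x m `<=` factors s m) ->
  factors x n = factors s n.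
Proof.
move=> st nper sub; apply/seteqP; split; first exact: sub.
have [L [uL sL LF]] : exists L, [/\ uniq L, size L = n.+1 &
    forall u, u \in L -> factors x n u].
  elim: n => [|n [L [uL sL LF]]].
    exists [:: [::]]; split=> // u; rewrite inE => /eqP ->; by exists 0%N.
  have [T [uT sT TF]] := sturmian_factors_seq n st.
  have [u su] : exists u, right_special x n u.
    apply: contrapT => ns; apply: nper.
    apply: (@nonspecial_ultimately_periodic x n 0 T) => t _; split.
      by apply/TF/sub; exists t; rewrite // add0n.
    by move=> sp; apply: ns; exists (factor x (0 + t) n).
  have uL' : uniq (undup (u :: L)) by rewrite undup_uniq.
  have [||||L' [uL1 sL1 LF1]] :=
    @factors_extend x n (undup (u :: L)) [:: u] uL'.
  - move=> v; rewrite mem_undup inE => /orP[/eqP ->|/LF //].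
    by case: su => i [_ [<- _ _]]; exists i.
  - by [].
  - by move=> v; rewrite inE => /eqP ->; rewrite mem_undup mem_head.
  - by move=> v; rewrite inE => /eqP ->.
  have le : (n.+2 <= size L')%N.
    rewrite sL1 addn1 ltnS -sL; apply: uniq_leq_size => // v vL.
    by rewrite mem_undup inE vL orbT.
  exists (take n.+2 L'); split; first exact: take_uniq.
    exact: size_takel.
  by move=> v /mem_take /LF1.
have [T [uT sT TF]] := sturmian_factors_seq n st.
have subT : {subset L <= T} by move=> u /LF /sub /TF.
have [_ eLT] := uniq_min_size uL subT (eq_leq (etrans sT (esym sL))).
by move=> u /TF; rewrite -eLT => /LF.
Qed.

Lemma ones_add_eq (x w : word) k j :
  (forall i, (i < j)%N -> x (k + i)%N = w i) ->
  ones x (k + j) = (ones x k + ones w j)%N.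
Proof.
elim: j => [|j IH] e; first by rewrite addn0 ones0 addn0.
rewrite addnS !onesS IH ?e ?addnA // => i ij; apply: e; exact: ltnW.
Qed.

Lemma ones_ultimately_periodic (x : word) N p :
  (forall n, (N <= n)%N -> x (n + p)%N = x n) ->
  forall k, (ones x (N + k * p) + k * ones x N =
             ones x N + k * ones x (N + p))%N.
Proof.
move=> per; have step m : (ones x (N + m + p) + ones x N =
    ones x (N + m) + ones x (N + p))%N.
  elim: m => [|m IH]; first by rewrite addn0 addnC.
  by rewrite addnS addSn !onesS per; lia.
elim=> [|k IH]; first by rewrite !mul0n !addn0.
have -> : (N + k.+1 * p = N + k * p + p)%N by lia.
by have := step (k * p)%N; lia.
Qed.

Lemma nondecreasing_bounded_stationary (f : nat -> int) (B : int) :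
  (forall n, f n <= f n.+1) -> (forall n, f n <= B) ->
  exists N, forall n, (N <= n)%N -> f n = f N.
Proof.
move=> inc bnd.
have mono m n : (m <= n)%N -> f m <= f n.
  by move=> /subnKC <-; elim: (n - m)%N => [|k IH];
    rewrite ?addn0 // addnS (le_trans IH).
have [k] : exists k : nat, B - f 0%N <= k.
  by exists `|B - f 0%N|%N; lia.
move: 0%N; elim: k => [|k IH] m Hm.
  by exists m => n /mono; have := bnd n; lia.
have [|/existsNP[n /not_implyP[mn ne]]] :=
  pselect (forall n, (m <= n)%N -> f n = f m); first by exists m.
by apply: (IH n); have := mono _ _ mn; lia.
Qed.

(* [w] bounds every tail of [x] in the lexicographic order. *)
Definition lex_dominated (x w : word) : Prop :=
  forall k j, (forall i, (i < j)%N -> x (k + i)%N = w i) ->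
    (x (k + j)%N <= w j)%N.

Lemma ones_lex_dominated (x w : word) :
  (forall k j, (ones x (k + j) <= ones x k + ones w j)%N) -> lex_dominated x w.
Proof.
move=> le k j e; have := le k j.+1; rewrite addnS !onesS (ones_add_eq e); lia.
Qed.

Lemma height_factor (x : word) n :
  binary x -> height (factor x 0 n) = ones x n.
Proof.
move=> bin; elim: n => [|n IH]; first by rewrite ones0.
rewrite factorS /height -cats1 count_cat -/(height _) IH onesS /= addn0.
by case: (x n) (bin n) => [|[]].
Qed.

(** * Slope and mechanical words *)

Section Slope.
Variable R : realType.
Implicit Types alpha : R.

Lemma natmul_bounded_le0 (x C : R) :
  (forall k : nat, k%:R * x <= C) -> x <= 0.
Proof.
move=> H; rewrite leNgt; apply/negP => x0.
have C0 : 0 <= C by have := H 0%N; rewrite mul0r.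
have := archi_boundP (divr_ge0 C0 (ltW x0)).
by rewrite ltr_pdivrMr // ltNge H.
Qed.

(** The prefix of length [k * n] splits into [k] blocks, each within one of the window at [i] by
    balance; for large [k] the block average approaches [alpha * n]. *)
Lemma sturmian_discrepancy_le1 (s : word) alpha i n :
  sturmian s -> has_slope s alpha ->
  `|(ones s (i + n))%:R - (ones s i)%:R - alpha * n%:R| <= 1.
Proof.
move=> st sl; have [->|n0] := posnP n.
  by rewrite addn0 mulr0 subr0 subrr normr0.
have blk k : (ones s (k * n) + k * ones s i <= k * ones s (i + n) + k)%N /\
    (k * ones s (i + n) <= ones s (k * n) + k * ones s i + k)%N.
  elim: k => [|k [IH1 IH2]]; first by rewrite !mul0n ones0.
  have b1 := sturmian_balanced n i (k * n) st.
  have b2 := sturmian_balanced n (k * n) i st.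
  by rewrite !mulSn [(n + _)%N]addnC; lia.
set c := (_ - _ - _ : R); rewrite leNgt; apply/negP => c1.
have nR : (0 : R) < n%:R by rewrite ltr0n.
have e0 : 0 < (`|c| - 1) / n%:R by rewrite divr_gt0 // subr_gt0.
move/cvgrPdist_lt: sl => /(_ _ e0) [N _ HN].
have := HN (N.+1 * n)%N; rewrite /= => /(_ _) HN1.
have {HN1} := HN1 (leq_trans (leqnSn N) (leq_pmulr _ n0)).
rewrite (height_factor _ st.1) natrM; set k := N.+1%:R; set S := _%:R.
have k0 : (0 : R) < k by rewrite ltr0n.
have kn0 : 0 < k * n%:R by rewrite mulr_gt0.
have -> : alpha - S / (k * n%:R) = (alpha * (k * n%:R) - S) / (k * n%:R).
  by field; rewrite !gt_eqF.
rewrite normrM normfV (gtr0_norm kn0) ltr_pdivrMr //.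
have -> : (`|c| - 1) / n%:R * (k * n%:R) = k * `|c| - k.
  by field; rewrite gt_eqF.
have le : `|k * (c + alpha * n%:R) - S| <= k.
  have [b1 b2] := blk N.+1; rewrite /c subrK ler_norml.
  move: b1 b2; rewrite -!(ler_nat R) !natrD !natrM -/k -/S => b1 b2.
  by apply/andP; split; lra.
move=> lt; have : `|k * c| < k * `|c|.
  have -> : k * c =
      (k * (c + alpha * n%:R) - S) - (alpha * (k * n%:R) - S) by ring.
  apply: le_lt_trans (ler_normB _ _) _; lra.
by rewrite normrM (gtr0_norm k0) ltxx.
Qed.

Definition irrational alpha : Prop :=
  forall (q : nat) (p : int), (0 < q)%N -> alpha * q%:R <> p%:~R.

(* If [alpha * q = p], the number of ones in the windows of length [q] deviates
   from [p] in one direction only, and the sum of the deviations is bounded, so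
   they vanish eventually and [q] is a period. *)
Lemma sturmian_slope_irrational (s : word) alpha :
  sturmian s -> has_slope s alpha -> irrational alpha.
Proof.
move=> st sl q p q0 eqp.
pose E n : int := (ones s (n + q))%:Z - (ones s n)%:Z - p.
(* [H n] adds the deviations of the [q] windows of length [n] starting below [q]. Since
   [alpha * q = p], it stays within [q], and its increments telescope to [E n]. *)
pose H n : int :=
  \sum_(0 <= l < q) ((ones s (l + n))%:Z - (ones s l)%:Z) - p * n%:Z.
have HS n : H n.+1 = H n + E n.
  rewrite /H /E.
  have -> : \sum_(0 <= l < q) ((ones s (l + n.+1))%:Z - (ones s l)%:Z) =
     \sum_(0 <= l < q) ((ones s (l + n))%:Z - (ones s l)%:Z) +
     \sum_(0 <= l < q) ((ones s (l.+1 + n))%:Z - (ones s (l + n))%:Z).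
    by rewrite -big_split /=; apply: eq_bigr => l _; rewrite addnS addSn; ring.
  rewrite (telescope_sumr (fun l => (ones s (l + n))%:Z)) // add0n addnC intS.
  ring.
have Hb n : `|H n| <= q%:Z.
  rewrite -(ler_int R) -[(_ : int)%:~R]/(`|H n|%:~R) intr_norm /H intrB intrM.
  rewrite -eqp [n%:Z%:~R]/(n%:R) rmorph_sum /=.
  have -> : alpha * q%:R * n%:R = \sum_(0 <= l < q) (alpha * n%:R).
    by rewrite sumr_const_nat subn0 -mulr_natr; ring.
  rewrite -sumrB; apply: le_trans (ler_norm_sum _ _ _) _.
  have -> : (q%:Z%:~R : R) = \sum_(0 <= l < q) 1.
    by rewrite sumr_const_nat subn0.
  by apply: ler_sum => l _; rewrite rmorphB; exact: sturmian_discrepancy_le1.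
have Ebal i j : E i <= E j + 1.
  by have := sturmian_balanced q i j st; rewrite /E; lia.
have E1 i : `|E i| <= 1.
  rewrite -(ler_int R) intr_norm /E !rmorphB /= -eqp.
  exact: sturmian_discrepancy_le1.
have [N HN] : exists N, forall n, (N <= n)%N -> H n = H N.
  (* Values of [E] differ by at most one, so a positive value excludes negative ones; in both cases
     [H] is monotone. *)
  have [[i Ei]|nex] := pselect (exists i, 0 < E i).
    apply: (@nondecreasing_bounded_stationary H q%:Z) => n.
      by rewrite HS; have := Ebal i n; lia.
    by have := Hb n; lia.
  have [||N HN] := @nondecreasing_bounded_stationary (fun n => - H n) q%:Z.
  - move=> n; rewrite HS; have : ~ 0 < E n by move=> ?; apply: nex; exists n.
    by lia.
  - by move=> n; have := Hb n; lia.
  by exists N => n /HN /oppr_inj.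
apply: (sturmian_not_ultimately_periodic st); exists N, q; split=> // n Nn.
have e1 := HS n; rewrite !HN // in e1; last exact: leqW.
have e2 := HS n.+1; rewrite !HN // in e2; [|exact: leqW|exact/leqW/leqW].
by move: e1 e2; rewrite /E addSn !onesS; lia.
Qed.

Lemma sturmian_discrepancy_lt1 (s : word) alpha i n :
  sturmian s -> has_slope s alpha -> (0 < n)%N ->
  `|(ones s (i + n))%:R - (ones s i)%:R - alpha * n%:R| < 1.
Proof.
move=> st sl n0; have irr := sturmian_slope_irrational st sl.
rewrite lt_neqAle sturmian_discrepancy_le1 // andbT.
set c := _%:R - _%:R; have cE : c = ((ones s (i + n))%:Z - (ones s i)%:Z)%:~R.
  by rewrite rmorphB.
apply/negP; rewrite eqr_norml => /andP[/orP[] /eqP e _].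
  apply: (irr n ((ones s (i + n))%:Z - (ones s i)%:Z - 1) n0).
  by rewrite rmorphB /= -cE; lra.
apply: (irr n ((ones s (i + n))%:Z - (ones s i)%:Z + 1) n0).
by rewrite rmorphD /= -cE; lra.
Qed.

Lemma slope_ge0 (s : word) alpha : has_slope s alpha -> 0 <= alpha.
Proof.
move=> sl; rewrite -(cvg_lim (@Rhausdorff R) sl); apply: limr_ge.
  by apply/cvg_ex; exists alpha.
by near=> n; rewrite divr_ge0.
Unshelve. all: by end_near.
Qed.

(** * Mechanical words *)

(** The absolute value turns integer letters into naturals; it changes nothing once [0 <= alpha]. *)
Definition mechanical_word alpha : word := fun n => `|mechanical' alpha n|%N.

Lemma mechanical_wordE alpha n : 0 <= alpha ->
  (mechanical_word alpha n)%:Z = mechanical' alpha n.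
Proof.
move=> a0; rewrite /mechanical_word gez0_abs // /mechanical' subr_ge0.
by apply: ceil_le; rewrite ler_wpM2l // ler_nat.
Qed.

Lemma ones_mechanical_word alpha n : 0 <= alpha ->
  (ones (mechanical_word alpha) n)%:Z = Num.ceil (alpha * n%:R).
Proof.
move=> a0; elim: n => [|n IH]; first by rewrite ones0 mulr0 ceil0.
by rewrite onesS PoszD IH mechanical_wordE // /mechanical' addrC subrK.
Qed.

Lemma ones_mechanical_word_itv alpha n : 0 <= alpha ->
  alpha * n%:R <= (ones (mechanical_word alpha) n)%:R < alpha * n%:R + 1.
Proof.
move=> a0; have := ceil_itv (alpha * n%:R).
rewrite -ones_mechanical_word // rmorphB /= => /andP[h1 h2].
by rewrite h2 /= -ltrBlDr.
Qed.

(** Along [N + k * p] the count of ones grows by a fixed integer per period and stays within one of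
    [alpha] times the length, so [alpha * p] would be that integer. *)
Lemma mechanical_word_not_ultimately_periodic alpha :
  0 <= alpha -> irrational alpha ->
  ~ ultimately_periodic (mechanical_word alpha).
Proof.
move=> a0 irr [N [p [p0 per]]]; set w := mechanical_word alpha in per.
have Hk := ones_ultimately_periodic per.
pose c : R := (ones w (N + p))%:R - (ones w N)%:R - alpha * p%:R.
have kc (k : nat) : `|k%:R * c| <= 1.
  have /andP[l1 u1] := ones_mechanical_word_itv (N + k * p) a0.
  have /andP[l2 u2] := ones_mechanical_word_itv N a0.
  have := congr1 (fun n => n%:R : R) (Hk k); rewrite !natrD !natrM /c.
  move: l1 u1 l2 u2; rewrite -/w natrD natrM => l1 u1 l2 u2 e.
  by rewrite ler_norml; apply/andP; split; lra.
have c0 : c = 0.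
  apply/eqP; rewrite -normr_le0; apply: (@natmul_bounded_le0 _ 1) => k.
  by have := kc k; rewrite normrM normr_nat.
apply: (irr p ((ones w (N + p))%:Z - (ones w N)%:Z) p0).
by rewrite rmorphB /=; move: c0; rewrite /c; lra.
Qed.

Lemma mechanical_word_lex_dominated alpha : 0 <= alpha ->
  lex_dominated (mechanical_word alpha) (mechanical_word alpha).
Proof.
move=> a0; apply: ones_lex_dominated => k j.
rewrite -lez_nat PoszD !ones_mechanical_word // ceil_le_int natrD mulrDr.
by rewrite rmorphD /= lerD // ceil_ge.
Qed.

Lemma sturmian_lex_dominated (s : word) alpha :
  sturmian s -> has_slope s alpha -> lex_dominated s (mechanical_word alpha).
Proof.
move=> st sl; have a0 := slope_ge0 sl; apply: ones_lex_dominated => k j.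
have [->|j0] := posnP j; first by rewrite addn0 leq_addr.
have := sturmian_discrepancy_lt1 k st sl j0; rewrite ltr_norml => /andP[_ h].
have /andP[h' _] := ones_mechanical_word_itv j a0.
by rewrite -ltnS -(ltr_nat R) -natr1 natrD; lra.
Qed.

(** [d] is the least of 1 and the fractional parts of [alpha * j], positive by irrationality. *)
Lemma irrational_gap alpha n : irrational alpha ->
  exists2 d : R, 0 < d & forall j (c : int), (0 < j <= n)%N ->
    c%:~R < alpha * j%:R -> c%:~R + d <= alpha * j%:R.
Proof.
move=> irr; elim: n => [|n [d d0 Hd]]; first by exists 1 => // j c; lia.
pose f := alpha * n.+1%:R - (Num.floor (alpha * n.+1%:R))%:~R.
have f0 : 0 < f.
  rewrite subr_gt0 lt_neqAle floor_le andbT; apply/eqP => e.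
  by apply: (irr n.+1 (Num.floor (alpha * n.+1%:R))).
exists (Num.min d f); first by rewrite lt_min d0.
move=> j c; have [-> _ lt|ne jn lt] := eqVneq j n.+1.
  have : c%:~R <= (Num.floor (alpha * n.+1%:R))%:~R :> R.
    by rewrite ler_int floor_ge_int ltW.
  have : Num.min d f <= f by rewrite ge_min lexx orbT.
  by rewrite /f; lra.
apply: le_trans (Hd j c _ lt); last lia.
by rewrite lerD2l ge_min lexx.
Qed.

(* The prefix is found where the discrepancy [ones s i - alpha * i] is minimal
   on the window [i, i + n]; such an [i] exists because the discrepancy is
   bounded below while its drops over at most [n] letters are bounded away
   from [0]. *)
Lemma mechanical_word_prefix (s : word) alpha n :
  sturmian s -> has_slope s alpha ->
  exists i, forall j, (j < n)%N -> s (i + j)%N = mechanical_word alpha j.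
Proof.
move=> st sl; have a0 := slope_ge0 sl.
have irr := sturmian_slope_irrational st sl.
have [d d0 gap] := irrational_gap n irr.
pose D i : R := (ones s i)%:R - alpha * i%:R.
have [i Hi] : exists i, forall j, (0 < j <= n)%N -> D i <= D (i + j)%N.
  apply: contrapT => /forallNP nex.
  have drop i : exists i', D i' <= D i - d.
    have /existsNP[j /not_implyP[jn /negP]] := nex i.
    rewrite -ltNge /D natrD mulrDr => lt; exists (i + j)%N.
    have := gap j ((ones s (i + j))%:Z - (ones s i)%:Z) jn.
    rewrite rmorphB /= natrD mulrDr => /(_ _) g.
    suff : (ones s (i + j))%:R - (ones s i)%:R < alpha * j%:R.
      by move=> /g; lra.
    by lra.
  have far k : exists i, D i <= - (k%:R * d).
    elim: k => [|k [i Hi]].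
      by exists 0%N; rewrite /D ones0 mulr0 subrr mul0r oppr0.
    by have [i' Hi'] := drop i; exists i'; rewrite -natr1; lra.
  suff : d <= 0 by rewrite leNgt d0.
  apply: (@natmul_bounded_le0 _ 1) => k; have [i Hi] := far k.
  have := sturmian_discrepancy_le1 0 i st sl; rewrite add0n ones0 subr0.
  by rewrite ler_norml -/(D i) => /andP[]; lra.
exists i => j jn.
have onesE m : (m <= n)%N ->
    ones s (i + m) = (ones s i + ones (mechanical_word alpha) m)%N.
  have [->|m0] := posnP m; first by rewrite addn0 ones0 addn0.
  move=> mn.
  (* Minimality at [i] gives at least [alpha * m] ones, the discrepancy bound fewer than
     [alpha * m + 1]: only the ceiling is left. *)
  have : Num.ceil (alpha * m%:R) = (ones s (i + m))%:Z - (ones s i)%:Z.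
    apply/eqP; rewrite ceil_eq !rmorphB /=.
    have := sturmian_discrepancy_lt1 i st sl m0; rewrite ltr_norml.
    have := Hi m; rewrite m0 mn /D natrD mulrDr => /(_ isT) h1 /andP[h2 h3].
    by apply/andP; split; lra.
  by rewrite -ones_mechanical_word //; lia.
have := onesE j (ltnW jn); have := onesE j.+1 jn.
by rewrite addnS !onesS; lia.
Qed.

Lemma sturmian_factors_mechanical (s : word) alpha n :
  sturmian s -> has_slope s alpha ->
  factors (mechanical_word alpha) n = factors s n.
Proof.
move=> st sl; apply: sturmian_factors_eq => //.
  apply: mechanical_word_not_ultimately_periodic; first exact: slope_ge0 sl.
  exact: sturmian_slope_irrational st sl.
move=> m _ [i _ <-]; have [k Hk] := mechanical_word_prefix (i + m) st sl.
exists (k + i)%N => //; apply/eq_factorP => j jm.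
by rewrite -addnA Hk // ltn_add2l.
Qed.

Lemma orbit_closure_mechanical (s : word) alpha :
  sturmian s -> has_slope s alpha ->
  orbit_closure (mechanical_word alpha) = orbit_closure s.
Proof.
move=> st sl; apply/seteqP; split=> t /orbit_closureP H;
  apply/orbit_closureP => n.
  by rewrite -(sturmian_factors_mechanical n st sl).
by rewrite (sturmian_factors_mechanical n st sl).
Qed.

End Slope.

(** * Beta-shifts *)

Section BetaShift.
Variable R : realType.
Implicit Types (b c : R) (x w t : word).

(** * Digit sums in a given base *)

Definition tail_sum b x (k n : nat) : R :=
  \sum_(0 <= i < n) (x (k + i)%N)%:R / b ^+ i.+1.

Lemma tail_sum0 b x k : tail_sum b x k 0 = 0.
Proof. exact: big_geq. Qed.

Lemma tail_sumS b x k n :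
  tail_sum b x k n.+1 = tail_sum b x k n + (x (k + n)%N)%:R / b ^+ n.+1.
Proof. exact: big_nat_recr. Qed.

Lemma eq_tail_sum b x w k l n :
  (forall i, (i < n)%N -> x (k + i)%N = w (l + i)%N) ->
  tail_sum b x k n = tail_sum b w l n.
Proof. by move=> e; apply: eq_big_nat => i /andP[_ /e ->]. Qed.

Lemma tail_sumD b x k j n : b != 0 ->
  tail_sum b x k (j + n) = tail_sum b x k j + tail_sum b x (k + j) n / b ^+ j.
Proof.
move=> b0; elim: n => [|n IH]; first by rewrite addn0 tail_sum0 mul0r addr0.
rewrite addnS !tail_sumS IH mulrDl addrA -!addnA; congr (_ + _).
by rewrite -addnS exprD invfM mulrA mulrAC.
Qed.

Lemma le_tail_sum b x k m n : 0 < b -> (m <= n)%N ->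
  tail_sum b x k m <= tail_sum b x k n.
Proof.
move=> b0 /subnKC <-; rewrite tail_sumD ?gt_eqF // lerDl.
by rewrite divr_ge0 ?exprn_ge0 ?(ltW b0) ?sumr_ge0 // => i _;
  rewrite divr_ge0 ?exprn_ge0 ?(ltW b0).
Qed.

Lemma tail_sum_ge0 b x k n : 0 < b -> 0 <= tail_sum b x k n.
Proof. by move=> b0; rewrite -(tail_sum0 b x k) le_tail_sum. Qed.

(** Otherwise all letters from [k + n] on vanish. This makes upper bounds on the sums strict. *)
Lemma tail_sum_not_max b x k n : 0 < b -> ~ ultimately_periodic x ->
  exists m, tail_sum b x k n < tail_sum b x k m.
Proof.
move=> b0 nper.
have [m [nm xm]] : exists m, (n <= m)%N /\ (0 < x (k + m))%N.
  apply: contrapT => /forallNP nex; apply: nper; exists (k + n)%N, 1%N.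
  have x0 m : (k + n <= m)%N -> x m = 0%N.
    move=> h; have /not_andP[|/negP] := nex (m - k)%N; first lia.
    by rewrite subnKC; lia.
  by split=> // m h; rewrite !x0 //; lia.
exists m.+1; rewrite tail_sumS; apply: le_lt_trans (le_tail_sum x k b0 nm) _.
by rewrite ltrDl divr_gt0 ?exprn_gt0 ?ltr0n.
Qed.

(** Passing from [b] to [b'] multiplies term [i] by the power [i.+1] of [b / b'], which is at least
    [b / b']. *)
Lemma tail_sum_scale b b' x k n : 0 < b' -> b' <= b ->
  b / b' * tail_sum b x k n <= tail_sum b' x k n.
Proof.
move=> b'0 b'b; have b0 := lt_le_trans b'0 b'b.
rewrite mulr_sumr; apply: ler_sum => i _.
rewrite mulrCA ler_wpM2l //.
have -> : b / b' * b ^- i.+1 = b' ^- i.+1 * (b' / b) ^+ i.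
  by rewrite expr_div_n !exprS; field; rewrite !gt_eqF // exprn_gt0.
rewrite ler_piMr ?invr_ge0 ?exprn_ge0 ?(ltW b'0) // exprn_ile1 //.
  by rewrite divr_ge0 // ltW.
by rewrite ler_pdivrMr // mul1r.
Qed.

(** By scaling, the sums at [b] are at most [b' / b], which is less than 1. *)
Lemma tail_sum_incompatible b b' x : 0 < b' -> b' < b ->
  (forall n, tail_sum b' x 0 n <= 1) ->
  ~ (forall e, 0 < e -> exists n, 1 - e < tail_sum b x 0 n).
Proof.
move=> b'0 b'b le1 /(_ (1 - b' / b))[|n].
  by rewrite subr_gt0 ltr_pdivrMr ?mul1r // (lt_trans b'0).
rewrite opprB addrC subrK ltNge => /negP; apply.
have b0 := lt_trans b'0 b'b.
have := le_trans (tail_sum_scale x 0 n b'0 (ltW b'b)) (le1 n).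
by rewrite -[b / b']invf_div mulrC ler_pdivrMr ?mul1r // divr_gt0.
Qed.

Lemma exprn_convex (l a c : R) n : 0 <= l <= 1 -> 0 <= a -> a <= c ->
  ((1 - l) * a + l * c) ^+ n <= (1 - l) * a ^+ n + l * c ^+ n.
Proof.
move=> /andP[l0 l1] a0 ac; elim: n => [|n IH]; first by rewrite !expr0; lra.
have an : a ^+ n <= c ^+ n by rewrite lerXn2r ?nnegrE // (le_trans a0).
rewrite exprSr; apply: le_trans (_ : ((1 - l) * a ^+ n + l * c ^+ n) *
  ((1 - l) * a + l * c) <= _).
  by rewrite ler_wpM2r // addr_ge0 ?mulr_ge0 ?subr_ge0 // (le_trans a0).
rewrite !exprSr -subr_ge0.
have -> : (1 - l) * (a ^+ n * a) + l * (c ^+ n * c) -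
   ((1 - l) * a ^+ n + l * c ^+ n) * ((1 - l) * a + l * c) =
   l * (1 - l) * ((c ^+ n - a ^+ n) * (c - a)) by ring.
by rewrite !mulr_ge0 ?subr_ge0.
Qed.

(* In [y = 1 / b] the sums are convex, and uniformly bounded at any [y < 1]. *)
Lemma tail_sum_perturb b c x : 1 < b -> c < 1 -> (forall i, (x i <= 1)%N) ->
  (forall n, tail_sum b x 0 n <= c) ->
  exists b', [/\ 1 < b', b' < b & forall n, tail_sum b' x 0 n <= 1].
Proof.
move=> b1 c1 x1 le.
have b0 : 0 < b by rewrite (lt_trans _ b1).
have c0 : 0 <= c by rewrite -(tail_sum0 b x 0).
pose y := b^-1; have y0 : 0 < y by rewrite invr_gt0.
have y1 : y < 1 by rewrite invf_lt1.
have sumE (z : R) n : tail_sum z^-1 x 0 n =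
    \sum_(0 <= i < n) (x i)%:R * z ^+ i.+1.
  by apply: eq_bigr => i _; rewrite exprVn invrK.
pose z := (1 + y) / 2; have yz : y < z by rewrite /z; lra.
have z1 : z < 1 by rewrite /z; lra.
have z0 : 0 < z by exact: lt_trans yz.
pose M := z / (1 - z); have M0 : 0 < M by rewrite divr_gt0 // subr_gt0.
have Mb n : tail_sum z^-1 x 0 n <= M.
  suff : tail_sum z^-1 x 0 n <= M * (1 - z ^+ n).
    move/le_trans; apply; rewrite ler_piMr ?(ltW M0) // gerBl.
    by rewrite exprn_ge0 // ltW.
  elim: n => [|n IH]; first by rewrite tail_sum0 expr0 subrr mulr0.
  rewrite tail_sumS exprVn invrK.
  have -> : M * (1 - z ^+ n.+1) = M * (1 - z ^+ n) + z ^+ n.+1.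
    by rewrite /M exprS; field; rewrite subr_eq0 gt_eqF.
  by rewrite lerD // ler_piMl ?exprn_ge0 ?(ltW z0) // lern1.
(* This weight gives [c + l * M = 1 - l]; the summand 1 in the denominator also keeps [l <= 1]. *)
pose l := (1 - c) / (M + 1).
have l0 : 0 < l by rewrite divr_gt0 ?subr_gt0 // addr_gt0.
have l1 : l <= 1 by rewrite ler_pdivrMr ?addr_gt0 //; lra.
have lM : l * M + l = 1 - c by rewrite /l; field; rewrite gt_eqF // addr_gt0.
pose y' := (1 - l) * y + l * z.
have yy' : y < y'.
  have -> : y' = y + l * (z - y) by rewrite /y'; ring.
  by rewrite ltrDl mulr_gt0 // subr_gt0.
have y'1 : y' < 1.
  have -> : y' = z - (1 - l) * (z - y) by rewrite /y'; ring.
  by apply: le_lt_trans z1; rewrite gerBl mulr_ge0 // subr_ge0 // ltW.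
have y'0 : 0 < y' by exact: lt_trans yy'.
exists y'^-1; split; first by rewrite invf_gt1.
  by rewrite -[b]invrK ltf_pV2.
move=> n; apply: le_trans (_ : (1 - l) * tail_sum b x 0 n +
    l * tail_sum z^-1 x 0 n <= _).
  rewrite -[b]invrK !sumE !mulr_sumr -big_split /=; apply: ler_sum => i _.
  rewrite mulrCA [l * _]mulrCA -mulrDr ler_wpM2l //.
  by apply: exprn_convex; rewrite ?l1 ?ltW.
have h1 : (1 - l) * tail_sum b x 0 n <= c.
  apply: le_trans (_ : tail_sum b x 0 n <= _) => //.
  by rewrite ler_piMl ?tail_sum_ge0 // gerBl ltW.
have h2 : l * tail_sum z^-1 x 0 n <= l * M by rewrite ler_wpM2l // ltW.
lra.
Qed.

Lemma first_difference x w k n :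
  (forall i, (i < n)%N -> x (k + i)%N = w i) \/
  exists j, [/\ (j < n)%N, forall i, (i < j)%N -> x (k + i)%N = w i &
    x (k + j)%N <> w j].
Proof.
elim: n => [|n [IH|[j [jn e ne]]]]; first by left.
  have [e|ne] := pselect (x (k + n)%N = w n); last by right; exists n.
  by left=> i; rewrite ltnS leq_eqVlt => /orP[/eqP ->|/IH].
by right; exists j; split=> //; exact: leqW.
Qed.

(** A letter smaller by at least one frees [1 / b ^+ j.+1], and the following letters of [x] use no
    more than that. *)
Lemma tail_sum_lex_lt b x w k j n : 0 < b ->
  (forall i, (i < j)%N -> x (k + i)%N = w i) -> (x (k + j)%N < w j)%N ->
  tail_sum b x (k + j.+1) n <= 1 ->
  tail_sum b x k (j.+1 + n) <= tail_sum b w 0 j.+1.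
Proof.
move=> b0 e lt le1; rewrite tail_sumD ?gt_eqF // !tail_sumS.
rewrite (@eq_tail_sum b x w k 0) // -addrA lerD2l -mulrDl add0n.
rewrite ler_wpM2r ?invr_ge0 ?exprn_ge0 ?(ltW b0) //.
by move: lt; rewrite -(ler_nat R) -natr1; lra.
Qed.

Lemma lex_dominated_tail_sum_le1 b x w k n : 0 < b -> lex_dominated x w ->
  (forall m, tail_sum b w 0 m <= 1) -> tail_sum b x k n <= 1.
Proof.
move=> b0 dom le1; elim/ltn_ind: n k => n IH k.
have [e|[j [jn e ne]]] := first_difference x w k n.
  by rewrite (@eq_tail_sum b x w k 0).
have lt : (x (k + j)%N < w j)%N by have := dom k j e; lia.
rewrite -(subnKC jn); apply: le_trans (le1 j.+1); apply: tail_sum_lex_lt => //.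
by apply: IH; lia.
Qed.

(** * Greedy expansions and membership in beta-shifts *)

Lemma beta_map_itv b (x : R) : 0 <= beta_map b x < 1.
Proof.
rewrite /beta_map subr_ge0 floor_le /= ltrBlDr addrC.
by have := floorD1_gt (b * x); rewrite rmorphD.
Qed.

Lemma iter_beta_map_ge0 b (x : R) n : 0 <= x -> 0 <= iter n (beta_map b) x.
Proof.
by case: n => //= n _; have /andP[] := beta_map_itv b (iter n (beta_map b) x).
Qed.

Lemma iter_beta_map_le1 b (x : R) n : x <= 1 -> iter n (beta_map b) x <= 1.
Proof.
case: n => //= n _.
by have /andP[_ /ltW] := beta_map_itv b (iter n (beta_map b) x).
Qed.

Lemma tail_sum_beta_expansion b (x : R) n : 0 < b -> 0 <= x ->
  x = tail_sum b (beta_expansion b x) 0 n + iter n (beta_map b) x / b ^+ n.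
Proof.
move=> b0 x0; elim: n => [|n IH]; first by rewrite tail_sum0 add0r divr1.
rewrite {1}IH tail_sumS -addrA; congr (_ + _).
rewrite add0n /beta_expansion iterS -mulrDl /beta_map.
have tn0 : 0 <= b * iter n (beta_map b) x.
  by rewrite mulr_ge0 ?iter_beta_map_ge0 // ltW.
rewrite truncn_floor tn0.
rewrite -[_%:R]/((`|Num.floor (b * iter n (beta_map b) x)|%N)%:Z%:~R).
rewrite gez0_abs ?floor_ge0 // addrC subrK exprS.
by field; rewrite !gt_eqF // exprn_gt0.
Qed.

(** [r] is a candidate orbit of [beta_map]: remainders in [0, 1) force each digit to be the floor.
    The range condition starts at [r 1], which admits the expansion of 1 from [r 0 = 1]. *)
Lemma beta_expansion_unique b (r : nat -> R) x N :
  (forall n, (n < N)%N -> b * r n = (x n)%:R + r n.+1) ->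
  (forall n, (n < N)%N -> 0 <= r n.+1 < 1) ->
  forall n, (n < N)%N -> beta_expansion b (r 0%N) n = x n.
Proof.
move=> rE r01.
have fl n : (n < N)%N -> Num.floor (b * r n) = (x n)%:Z.
  move=> nN; apply: floor_def; have /andP[h1 h2] := r01 n nN.
  by rewrite rE // rmorphD /= lerDl h1 ltrD2l.
have it n : (n <= N)%N -> iter n (beta_map b) (r 0%N) = r n.
  elim: n => //= n IH nN; rewrite IH ?(ltnW nN) // /beta_map fl // rE //.
  by rewrite addrC addKr.
move=> n nN; rewrite /beta_expansion it ?(ltnW nN) // truncn_floor fl //.
rewrite ifT // rE // addr_ge0 //; by have /andP[] := r01 n nN.
Qed.

Lemma beta_shift_tail_sum_le1 b t n : 0 < b -> beta_shift b t ->
  tail_sum b t 0 n <= 1.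
Proof.
move=> b0 /closure_wordP/(_ n)[_ [x /= /andP[x0 x1] <-] e].
rewrite -(@eq_tail_sum b (beta_expansion b x) t 0 0) //.
apply: le_trans (ltW x1); rewrite {2}(tail_sum_beta_expansion n b0 x0) lerDl.
by rewrite divr_ge0 ?iter_beta_map_ge0 ?exprn_ge0 // ltW.
Qed.

(* Cutting a tail of [s] after finitely many letters makes all its tail sums
   strictly smaller than [1], so the cut word is the expansion of its value. *)
Lemma orbit_closure_sub_beta_shift b (s w : word) : 0 < b ->
  lex_dominated s w -> ~ ultimately_periodic s ->
  (forall n, tail_sum b w 0 n <= 1) -> orbit_closure s `<=` beta_shift b.
Proof.
move=> b0 dom nper le1 t /closure_wordP H; apply/closure_wordP => n.
have [_ [k _ <-] e] := H n.
have lt1 k' m : tail_sum b s k' m < 1.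
  have [m' lt] := tail_sum_not_max k' m b0 nper.
  exact: lt_le_trans lt (lex_dominated_tail_sum_le1 _ _ b0 dom le1).
(* [r j] is the value of the cut word from letter [j] on, and [r n = 0]. *)
pose r j := tail_sum b s (k + j) (n - j).
exists (beta_expansion b (r 0%N)).
  by exists (r 0%N) => //=; rewrite tail_sum_ge0 // lt1.
move=> i ni; rewrite -e // iter_shiftE.
apply: (@beta_expansion_unique b r (fun i => s (k + i)%N) n) => // j jn.
  rewrite /r; have -> : (n - j = 1 + (n - j.+1))%N by lia.
  rewrite tail_sumD ?gt_eqF // tail_sumS tail_sum0 add0r addn0 addn1 addnS.
  by rewrite expr1; field; rewrite gt_eqF.
by rewrite tail_sum_ge0 // lt1.
Qed.

(** The witness is the [b]-expansion of a number strictly between [b' / b] and 1: its sums at [b]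
    tend to that number, but in the [b']-shift they could not exceed [b' / b]. *)
Lemma beta_shift_not_sub b b' : 1 < b' -> b' < b ->
  ~ beta_shift b `<=` beta_shift b'.
Proof.
move=> b'1 b'b sub.
have b'0 : 0 < b' by rewrite (lt_trans _ b'1).
have b0 := lt_trans b'0 b'b; have b1 := lt_trans b'1 b'b.
pose q := b' / b; have q0 : 0 < q by rewrite divr_gt0.
have q1 : q < 1 by rewrite ltr_pdivrMr // mul1r.
pose x := (1 + q) / 2.
have x0 : 0 <= x by rewrite /x; lra.
have x1 : x <= 1 by rewrite /x; lra.
have /sub bx : beta_shift b (beta_expansion b x).
  by apply: subset_closure; exists x => //=; rewrite x0 /=; rewrite /x; lra.
have le n : tail_sum b (beta_expansion b x) 0 n <= q.
  have := beta_shift_tail_sum_le1 n b'0 bx.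
  move/(le_trans (tail_sum_scale _ _ _ b'0 (ltW b'b))).
  by rewrite -[b / b']invf_div mulrC ler_pdivrMr ?mul1r.
have xq : 0 < x - q by rewrite /x; lra.
have [n Hn] : exists n, b ^- n < x - q.
  have bb : `|b^-1| < 1 by rewrite ger0_norm ?invf_lt1 // invr_ge0 ltW.
  have /cvgrPdist_lt/(_ _ xq)[n _ Hn] := cvg_expr bb.
  exists n; have := Hn n (leqnn n); rewrite /= sub0r normrN.
  by rewrite exprVn ger0_norm // invr_ge0 exprn_ge0 // ltW.
have := tail_sum_beta_expansion n b0 x0; have := le n.
have : iter n (beta_map b) x / b ^+ n <= b ^- n.
  by rewrite ler_piMl ?iter_beta_map_le1 // invr_ge0 exprn_ge0 // ltW.
lra.
Qed.

(* [r k = b ^ k (1 - sum_(i < k) w_i / b ^ (i + 1))] is the value of the [k]-th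
   tail of [w]; the strict lexicographic inequality makes it smaller than [1]
   for [k > 0]. *)
Lemma beta_expansion1_lex_max b w : 0 < b -> lex_dominated w w ->
  ~ ultimately_periodic w -> (forall n, tail_sum b w 0 n <= 1) ->
  (forall e, 0 < e -> exists n, 1 - e < tail_sum b w 0 n) ->
  beta_expansion b 1 = w.
Proof.
move=> b0 dom nper le1 sup1.
pose r k := b ^+ k * (1 - tail_sum b w 0 k).
have bn0 n : 0 < b ^+ n by rewrite exprn_gt0.
have r_lt1 k : (0 < k)%N -> r k < 1.
  move=> k0.
  have [j [e ne]] : exists j, (forall i, (i < j)%N -> w (k + i)%N = w i) /\
      w (k + j)%N <> w j.
    apply: contrapT => nex; apply: nper; exists 0%N, k; split=> // n _.
    have [e|[j [_ e ne]]] := first_difference w w k n.+1.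
      by rewrite addnC e.
    by case: nex; exists j.
  have lt : (w (k + j)%N < w j)%N by have := dom k j e; lia.
  have [m Hm] := tail_sum_not_max 0 j.+1 b0 nper.
  have A1 : tail_sum b w 0 j.+1 < 1 := lt_le_trans Hm (le1 m).
  (* Otherwise all sums of [w] would be at most [tail_sum b w 0 k + tail_sum b w 0 j.+1 / b ^+ k],
     which is less than 1, against [sup1]. *)
  apply: le_lt_trans A1; rewrite leNgt; apply/negP.
  rewrite /r => ltr; set A := tail_sum b w 0 j.+1 in ltr.
  have e0 : 0 < (1 - tail_sum b w 0 k) - A / b ^+ k.
    by rewrite subr_gt0 ltr_pdivrMr // mulrC.
  have [n] := sup1 _ e0.
  rewrite !opprB addrCA [1 + _]addrC subrK ltNge => /negP; apply.
  apply: le_trans (_ : tail_sum b w 0 (k + (j.+1 + n)) <= _).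
    by rewrite le_tail_sum //; lia.
  rewrite tail_sumD ?gt_eqF // add0n [X in _ <= X]addrC lerD2l.
  rewrite ler_pM2r ?invr_gt0 //; apply: tail_sum_lex_lt => //.
  exact: lex_dominated_tail_sum_le1 b0 dom le1.
have r0 : r 0%N = 1 by rewrite /r tail_sum0 subr0 mulr1.
apply/funext => n; rewrite -r0.
apply: (@beta_expansion_unique b r w n.+1) => // k kn.
  rewrite /r tail_sumS add0n exprS; field.
  by rewrite !gt_eqF.
by rewrite r_lt1 // /r mulr_ge0 ?subr_ge0 // ltW.
Qed.

End BetaShift.

Theorem theorem8 (R : realType) (s : word) (alpha beta : R)
  (s_sturmian : sturmian s) (s_slope : has_slope s alpha)
  (beta_min : smallest_beta_shift beta (orbit_closure s)) :
  orbit_closure (beta_expansion beta 1) = orbit_closure s /\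
  unique
    (fun x : R => 1 < x /\
       series (fun n : nat => (mechanical' alpha n)%:~R / x ^+ n.+1 : R)
         @ \oo --> (1 : R))
    beta.
Proof.
have [beta1 sub min] := beta_min.
have beta0 : 0 < beta by rewrite (lt_trans _ beta1).
have a0 := slope_ge0 s_slope.
have irr := sturmian_slope_irrational s_sturmian s_slope.
set w := mechanical_word alpha.
have ocE : orbit_closure w = orbit_closure s.
  exact: orbit_closure_mechanical.
have nper := mechanical_word_not_ultimately_periodic a0 irr.
have seriesE (x : R) :
    series (fun n : nat => (mechanical' alpha n)%:~R / x ^+ n.+1 : R) =
    tail_sum x w 0.
  by apply/funext => n; apply: eq_bigr => i _; rewrite add0n -mechanical_wordE.
have w1 i : (w i <= 1)%N.
  have [k Hk] := mechanical_word_prefix i.+1 s_sturmian s_slope.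
  by rewrite /w -Hk // -ltnS; exact: s_sturmian.1.
have le1 n : tail_sum beta w 0 n <= 1.
  apply: beta_shift_tail_sum_le1 => //; apply: sub; rewrite -ocE.
  by apply/orbit_closureP => m; exists 0%N.
have sup1 e : 0 < e -> exists n, 1 - e < tail_sum beta w 0 n.
  move=> e0; apply: contrapT => /forallNP nex.
  have [||b' [b'1 b'b le1']] := @tail_sum_perturb R beta (1 - e) w beta1 _ w1.
  - by rewrite gtrBl.
  - by move=> n; rewrite leNgt; apply/negP.
  apply: (beta_shift_not_sub b'1 b'b); apply: min => //.
  apply: (@orbit_closure_sub_beta_shift _ _ _ w) => //.
  - by rewrite (lt_trans _ b'1).
  - exact: sturmian_lex_dominated.
  - exact: sturmian_not_ultimately_periodic.
have tail_cvg : tail_sum beta w 0 @ \oo --> (1 : R).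
  apply/cvgrPdist_lt => e e0; have [N HN] := sup1 e e0.
  exists N => // n /= Nn; have := le_tail_sum w 0 beta0 Nn.
  by have := le1 n; rewrite ger0_norm ?subr_ge0 //; lra.
split.
  rewrite -ocE; congr orbit_closure; apply: beta_expansion1_lex_max => //.
  exact: mechanical_word_lex_dominated.
split=> [|y [y1]]; first by rewrite seriesE.
rewrite seriesE => ycvg.
have y0 : 0 < y by rewrite (lt_trans _ y1).
(* A solution [y] shares two properties with [beta]: the sums are at most 1 and come arbitrarily
   close to 1. [tail_sum_incompatible] then excludes both strict orders. *)
have ymono : nondecreasing_seq (tail_sum y w 0).
  by move=> m n mn; exact: le_tail_sum.
have yle1 n : tail_sum y w 0 n <= 1.
  rewrite -(cvg_lim (@Rhausdorff R) ycvg); apply: nondecreasing_cvgn_le => //.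
  by apply/cvg_ex; exists 1.
have ysup1 e : 0 < e -> exists n, 1 - e < tail_sum y w 0 n.
  move=> e0; move/cvgrPdist_lt: ycvg => /(_ e e0)[N _ HN]; exists N.
  by have := HN N (leqnn N); rewrite /= ltr_norml => /andP[_]; lra.
have [lt|lt|//] := ltgtP beta y.
  by have := tail_sum_incompatible beta0 lt le1 ysup1.
by have := tail_sum_incompatible y0 lt yle1 sup1.
Qed.
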